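(* There exist absolute constants $c_0,c_1,c_2,C>0$ such that the following holds for all integers $m,p\ge2$ and all $x^*\in\mathbb{R}_+^p$ with support $S^*=\{k:x^*_k\neq0\}$ of size $s=|S^*|$, $1\le s<\min(m,p)$. If $$s\le c_0\min\left(\frac{\sqrt p}{\log p},\frac{m}{(\log p)^2}\right),$$ then, with probability exceeding $1-C/p$, the oracle least squares estimate $\hat x^{\rm OLS}$ of $x^*$ on $S^*$ satisfies $$c_1\sum_{k\in S^*}\big(\tilde A^\top(\tilde Y-\tilde Ax^* )\big)_k^2\ \le\ \|\hat x^{\rm OLS}-x^*\|_2^2\ \le\ c_2\sum_{k\in S^*}\big(\tilde A^\top(\tilde Y-\tilde Ax^* )\big)_k^2 .$$
   Context: Random convolution model: vectors in $\mathbb{R}^p$ are indexed by $\{0,\dots,p-1\}$ and indices are understood modulo $p$. $U_1,\dots,U_m$ are i.i.d. uniform on $\{0,\dots,p-1\}$; for $k\in\mathbb{Z}$, $\mathbb{N}(k)=\mathrm{card}\{i:U_i\equiv k \bmod p\}$; $A\in\mathbb{R}^{p\times p}$ is given by $A_{\ell,k}=\mathbb{N}(\ell-k)$. Conditionally on $U_1,\dots,U_m$, the entries of $Y\in\mathbb{R}^p$ are independent with $Y_\ell\sim\mathrm{Poisson}((Ax^* )_\ell)$. With $\mathbf 1\in\mathbb{R}^p$ the all-ones vector and $\overline Y=\frac1m\|Y\|_1$, $$\tilde A=\frac{1}{\sqrt m}A-\frac{\sqrt m-1}{p}\mathbf 1\mathbf 1^\top,\qquad \tilde Y_k=\frac1{\sqrt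 m}Y_k-\frac{\sqrt m-1}{p}\overline Y .$$ The oracle least squares estimate is $\hat x^{\rm OLS}=I_{S^*}(\tilde A_{S^*})^{\#}\tilde Y$, where $\tilde A_{S^*}$ and $I_{S^*}$ are the submatrices of $\tilde A$ and of the identity $I_p$ formed by the columns indexed by $S^*$ and $(\cdot)^{\#}$ is the (Moore–Penrose) pseudo-inverse; in particular $\hat x^{\rm OLS}$ vanishes outside $S^*$. *)

(* Defs.v *)
From HB Require Import structures.
From mathcomp Require Import all_boot all_order all_algebra.
From mathcomp Require Import all_classical all_reals all_analysis.

Set Implicit Arguments.
Unset Strict Implicit.
Unset Printing Implicit Defensive.

Import Order.TTheory GRing.Theory Num.Theory.
Import numFieldNormedType.Exports.

Local Open Scope classical_set_scope.
Local Open Scope ring_scope.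

Definition l1norm (R : realType) (n : nat) (v : 'cV[R]_n) : R :=
  \sum_i `|v i 0|.

Definition l2norm (R : realType) (n : nat) (v : 'cV[R]_n) : R :=
  Num.sqrt (\sum_i v i 0 ^+ 2).

Definition supp (R : realType) (n : nat) (v : 'cV[R]_n) : {set 'I_n} :=
  [set k | v k 0 != 0]%SET.

(* The four Penrose conditions; [pinvmx] of MathComp is only a partial inverse
   on the row space and does not satisfy them in general. *)
Definition moore_penrose (R : realType) (m n : nat)
    (A : 'M[R]_(m, n)) (X : 'M[R]_(n, m)) : Prop :=
  [/\ A *m X *m A = A, X *m A *m X = X,
      (A *m X)^T = A *m X & (X *m A)^T = X *m A].

(* The default value [0] is never used, see [mpinvP]. *)
Definition mpinv (R : realType) (m n : nat) (A : 'M[R]_(m, n)) : 'M[R]_(n, m) :=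
  xget 0 [set X | moore_penrose A X].

Lemma moore_penrose_uniq (R : realType) (m n : nat) (A : 'M[R]_(m, n))
    (X Y : 'M[R]_(n, m)) :
  moore_penrose A X -> moore_penrose A Y -> X = Y.
Proof.
move=> [AXA XAX AX XA] [AYA YAY AY YA].
have eAX : A *m X = A *m Y.
  have e : A *m X = A *m Y *m (A *m X) by rewrite mulmxA AYA.
  by rewrite -AX e trmx_mul AX AY mulmxA AXA.
have eXA : X *m A = Y *m A.
  have e : X *m A = X *m A *m (Y *m A) by rewrite -mulmxA (mulmxA A) AYA.
  by rewrite -XA e trmx_mul XA YA -mulmxA (mulmxA A) AXA.
by rewrite -XAX eXA -mulmxA eAX mulmxA YAY.
Qed.

Lemma gram_unitmx (R : realType) (r n : nat) (C : 'M[R]_(r, n)) :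
  row_free C -> C *m C^T \in unitmx.
Proof.
move=> fC; rewrite -row_free_unit -kermx_eq0; apply/eqP/row_matrixP => i.
rewrite row0; set v := row i _.
have vCC : v *m (C *m C^T) = 0.
  by apply/sub_kermxP; rewrite row_sub.
have vC : v *m C = 0.
  have : (v *m C *m (v *m C)^T) 0 0 = 0.
    by rewrite trmx_mul mulmxA -(mulmxA v) vCC mul0mx mxE.
  rewrite mxE => /eqP; rewrite psumr_eq0; last first.
    by move=> j _; rewrite [(_ ^T) _ _]mxE -expr2 sqr_ge0.
  move=> /allP h; apply/rowP => j; rewrite [RHS]mxE.
  have /implyP/(_ isT) := h j (mem_index_enum _).
  by rewrite [(_ ^T) _ _]mxE -expr2 sqrf_eq0 => /eqP.
by apply/eqP; rewrite -(mulmx_free_eq0 _ fC) vC.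
Qed.

Lemma moore_penrose_fact (R : realType) (m r n : nat)
    (B : 'M[R]_(m, r)) (C : 'M[R]_(r, n)) :
  row_free B^T -> row_free C ->
  moore_penrose (B *m C) (C^T *m invmx (C *m C^T) *m (invmx (B^T *m B) *m B^T)).
Proof.
move=> /gram_unitmx; rewrite trmxK => uB /gram_unitmx uC.
set G := invmx (C *m C^T); set H := invmx (B^T *m B).
have tG : G^T = G by rewrite /G trmx_inv trmx_mul trmxK.
have tH : H^T = H by rewrite /H trmx_inv trmx_mul trmxK.
have CG : C *m (C^T *m G) = 1%:M by rewrite mulmxA mulmxV.
have HB : H *m B^T *m B = 1%:M by rewrite -mulmxA mulVmx.
have AX : B *m C *m (C^T *m G *m (H *m B^T)) = B *m (H *m B^T).
  by rewrite -mulmxA (mulmxA C) CG mul1mx.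
have XA : C^T *m G *m (H *m B^T) *m (B *m C) = C^T *m G *m C.
  by rewrite -mulmxA (mulmxA (H *m _)) HB mul1mx.
split.
- by rewrite AX -mulmxA (mulmxA (H *m _)) HB mul1mx.
- by rewrite XA -[_ *m C *m _]mulmxA (mulmxA C) CG mul1mx.
- by rewrite AX !trmx_mul trmxK tH mulmxA.
- by rewrite XA !trmx_mul trmxK tG mulmxA.
Qed.

Lemma mpinvP (R : realType) (m n : nat) (A : 'M[R]_(m, n)) :
  moore_penrose A (mpinv A).
Proof.
suff [X AX] : exists X, moore_penrose A X.
  by rewrite /mpinv; case: xgetP => // /(_ X).
rewrite -[A]mulmx_base; eexists; apply: moore_penrose_fact.
  by rewrite /row_free mxrank_tr; exact: col_base_full.
exact: row_base_free.
Qed.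

Definition counts (m p : nat) (u : 'I_m -> 'I_p) (k : int) : nat :=
  #|[set i : 'I_m | ((u i)%:Z == k %[mod p])%Z]%SET|.

Definition convmx (R : realType) (m p : nat) (u : 'I_m -> 'I_p) : 'M[R]_p :=
  \matrix_(l, k) (counts u (l%:Z - k%:Z))%:R.

Definition ones (R : realType) (p : nat) : 'cV[R]_p := const_mx 1.

Definition tilde_mx (R : realType) (m p : nat) (u : 'I_m -> 'I_p) : 'M[R]_p :=
  (Num.sqrt m%:R)^-1 *: convmx R u
  - ((Num.sqrt m%:R - 1) / p%:R) *: (ones R p *m (ones R p)^T).

Definition tilde_vec (R : realType) (m p : nat) (y : 'cV[R]_p) : 'cV[R]_p :=
  let ybar := m%:R^-1 * l1norm y in
  (Num.sqrt m%:R)^-1 *: y - ((Num.sqrt m%:R - 1) / p%:R * ybar) *: ones R p.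

Definition colsel (R : realType) (n p : nat) (S : {set 'I_p})
    (B : 'M[R]_(n, p)) : 'M[R]_(n, #|S|) :=
  colsub (fun j : 'I_#|S| => enum_val j) B.

Definition oracle_ols (R : realType) (p : nat) (S : {set 'I_p})
    (At : 'M[R]_p) (Yt : 'cV[R]_p) : 'cV[R]_p :=
  colsel S 1%:M *m mpinv (colsel S At) *m Yt.

Definition iid_uniform d (T : measurableType d) (R : realType)
    (P : probability T R) (m p : nat) (U : 'I_m -> T -> 'I_p) : Prop :=
  [/\ forall i (B : set 'I_p), measurable (U i @^-1` B),
      forall i k, P (U i @^-1` [set k]) = (p%:R^-1)%:E
    & forall B : 'I_m -> set 'I_p,
        P [set w | forall i, B i (U i w)] = (\prod_i P (U i @^-1` B i))%E].

(* Since [U] has finitely many values, conditioning on [U] is elementary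
   conditioning on the events [U = u], written here multiplied out.
   [poisson_prob] at rate 0 is the Dirac mass at 0 (unlike [poisson_pmf], which
   is then constantly 1); its second argument is unused by the library. *)
Definition cond_poisson d (T : measurableType d) (R : realType)
    (P : probability T R) (m p : nat) (U : 'I_m -> T -> 'I_p)
    (rate : ('I_m -> 'I_p) -> 'cV[R]_p) (Y : 'I_p -> {RV P >-> nat}) : Prop :=
  forall (u : 'I_m -> 'I_p) (B : 'I_p -> set nat),
    P [set w | (forall i, U i w = u i) /\ (forall l, B l (Y l w))] =
    (P [set w | forall i, U i w = u i]
     * \prod_l poisson_prob (rate u l ord0) 0 (B l))%E.

(* Main.v *)
Require Import Defs.
From HB Require Import structures.
From mathcomp Require Import all_boot all_order all_algebra.
From mathcomp Require Import all_classical all_reals all_analysis.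
From mathcomp Require Import ring lra.

Set Implicit Arguments.
Unset Strict Implicit.
Unset Printing Implicit Defensive.

Import Order.TTheory GRing.Theory Num.Theory.
Import numFieldNormedType.Exports.

Local Open Scope classical_set_scope.
Local Open Scope ring_scope.

(** The least squares error [e = xhat - x] is supported on the support [S] of
    [x], and the normal equations turn the residual correlations
    [(At^T (Yt - At x))_k], for [k] in [S], into [(G e)_k], where [G] is the
    Gram matrix [At^T At] restricted to [S]
    ([oracle_ols_residual]). The two-sided bound thus says that [G] and its
    inverse are bounded, and it suffices that all entries of [G - 1] are at
    most [1 / (2 s)], for then [G - 1] has norm at most [1 / 2]
    ([near_identity_bounds]).

    The centering in [At] is exactly the one for which
    [G_kk' = (k == k') + autocorr (k - k') / m] ([gram_tilde_mx]), where
    [autocorr d] is the degenerate U-statistic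
    [sum_(i != j) (1_(U_i - U_j = d) - 1/p)]. It remains to prove, with
    [L = ln p], that outside an event of probability [O(1/p)],
    [|autocorr d| <= 50 L max(L, m / sqrt p)] for all [d]; the sparsity
    assumption with constant [1 / 100] makes this at most [m / (2 s)]
    ([sparsity_budget]).

    For this, the [U_i] are revealed one at a time. A new point [v] changes
    [autocorr d] by [excess (v + d) + excess (v - d)], where [excess u] is the
    number of past points equal to [u] minus its mean. These increments are
    centered given the past, so [autocorr d] is a martingale, whose increments
    and conditional variances are controlled as long as all the [excess u]
    are small. A Freedman-type exponential inequality for martingales
    stopped at the exit of such a region ([freedman]) is used twice: first for
    the martingales [excess u] themselves, to show that they stay small at all
    times ([excess_tail]), then for [autocorr d] stopped when some [excess u]
    becomes large ([autocorr_tail]). Since the [U_i] are uniform,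
    probabilities are proportions of tuples and conditional expectations are
    averages over the next entry, so the concentration part is finite
    counting. *)

(** * Exponential inequalities for stopped martingales on sequences *)

(** From [1 / expR y = expR (- y) >= 1 - y]. *)
Lemma expR_le_quadratic (R : realType) (y : R) :
  `|y| <= 2^-1 -> expR y <= 1 + y + 2 * y ^+ 2.
Proof.
rewrite ler_norml => /andP[h1 h2].
have e1 := expR_ge1Dx (- y).
have e0 := expR_gt0 y.
have e2 : expR y * expR (- y) = 1 by rewrite -expRD subrr expR0.
have e3 : expR y * (1 - y) <= expR y * expR (- y) by rewrite ler_pM2l.
have q : 0 <= y ^+ 2 * (1 - 2 * y) by rewrite mulr_ge0 ?sqr_ge0 //; lra.
have h : 0 < 1 - y by lra.
rewrite -(ler_pM2r h); apply: (le_trans e3); rewrite e2.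
rewrite -subr_ge0; apply: (le_trans q); rewrite le_eqVlt; apply/orP; left; apply/eqP; ring.
Qed.

Section Walks.
Variables (R : realType) (V : finType).
Implicit Types (D : seq V -> V -> R) (q : pred (seq V)) (h : seq V).

Lemma big_tuple_cons n (f : seq V -> R) :
  \sum_(t : n.+1.-tuple V) f t = \sum_(t : n.-tuple V) \sum_v f (v :: t).
Proof.
rewrite pair_big /=.
rewrite (reindex (fun z : n.-tuple V * V => [tuple of z.2 :: z.1])) //=.
exists (fun t : n.+1.-tuple V => ([tuple of behead t], thead t)).
  by case=> t v _ /=; congr (_, _); apply: val_inj.
by move=> t _; rewrite /= -tuple_eta.
Qed.

(** The value after the history [h], whose head is the most recent point, of
    the process whose increment is [D h v] when [v] is revealed after [h]. It
    is a martingale for uniform independent points as soon as every [D h]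
    sums to zero. *)
Fixpoint path_sum D h : R :=
  if h is v :: h' then path_sum D h' + D h' v else 0.

Lemma path_sumZ (c : R) D h :
  path_sum (fun h v => c * D h v) h = c * path_sum D h.
Proof. by elim: h => [|v h /= ->]; rewrite ?mulr0 // mulrDr. Qed.

Fixpoint all_tails q h : bool :=
  q h && (if h is _ :: h' then all_tails q h' else true).

Lemma all_tails_self {q h} : all_tails q h -> q h.
Proof. by case: h => [|v h] /= /andP[]. Qed.

(** The increments of the process stopped at the first exit from [q]: whether
    to move depends on all the prefixes in time, that is, the tails of [h]. *)
Definition stopped q D h v : R := if all_tails q h then D h v else 0.

Lemma path_sum_stopped q D h :
  all_tails q h -> path_sum (stopped q D) h = path_sum D h.
Proof.
by elim: h => [//|v h IH] /= /andP[_ th]; rewrite /stopped th IH.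
Qed.

(** This replaces a maximal inequality: a process that has left [[-K, K]] at
    some time is frozen there by the stopping, so that its exits are seen at
    the final time of the stopped process. *)
Lemma path_sum_stopped_exit (K : R) D h :
  let q h := `|path_sum D h| <= K in
  0 <= K -> ~~ all_tails q h -> K < `|path_sum (stopped q D) h|.
Proof.
move=> q K0; elim: h => [|v h IH] /=.
  by rewrite andbT /q /= normr0 K0.
rewrite /stopped; case: ifPn => th.
  by rewrite andbT /q -ltNge /= path_sum_stopped.
by move=> _; rewrite addr0; exact: IH.
Qed.

(** Induction on the number of points: averaged over the last point, the
    exponential of the last increment is at most [1 + 2 sigma] by the
    quadratic bound, the linear term having mean zero. *)
Lemma path_sum_mgf n (sigma : R) D :
  (forall h, (size h < n)%N -> \sum_v D h v = 0) ->
  (forall h v, (size h < n)%N -> `|D h v| <= 2^-1) ->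
  (forall h, (size h < n)%N -> \sum_v D h v ^+ 2 <= #|V|%:R * sigma) ->
  \sum_(t : n.-tuple V) expR (path_sum D t)
    <= (#|V|%:R * expR (2 * sigma)) ^+ n.
Proof.
elim: n => [|n IH] D0 Db D2.
  rewrite (big_pred1 [tuple]) ?expr0 ?expR0 // => t.
  by apply/esym/eqP; rewrite [t]tuple0.
rewrite (big_tuple_cons n (fun h => expR (path_sum D h))) exprS.
apply: (@le_trans _ _ (\sum_(t : n.-tuple V)
   (#|V|%:R * expR (2 * sigma)) * expR (path_sum D t))); last first.
  rewrite -mulr_sumr ler_wpM2l ?mulr_ge0 ?expR_ge0 //.
  by apply: IH => h; [| move=> v |] => /leqW; [exact: D0|exact: Db|exact: D2].
apply: ler_sum => t _ /=.
have st : (size t < n.+1)%N by rewrite size_tuple.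
under eq_bigr do rewrite expRD.
rewrite -mulr_sumr mulrC ler_wpM2r ?expR_ge0 //.
apply: (@le_trans _ _ (\sum_v (1 + D t v + 2 * D t v ^+ 2))).
  by apply: ler_sum => v _; apply: expR_le_quadratic; exact: Db.
rewrite !big_split /= D0 // addr0 -mulr_sumr sumr_const.
apply: (@le_trans _ _ (#|V|%:R * (1 + 2 * sigma))).
  by rewrite mulrDr mulr1 lerD2l mulrCA ler_wpM2l// D2.
by rewrite ler_wpM2l // expR_ge1Dx.
Qed.

(** Chernoff bound, applied to the process and to its opposite. *)
Lemma path_sum_tail n (sigma a : R) D :
  (forall h, (size h < n)%N -> \sum_v D h v = 0) ->
  (forall h v, (size h < n)%N -> `|D h v| <= 2^-1) ->
  (forall h, (size h < n)%N -> \sum_v D h v ^+ 2 <= #|V|%:R * sigma) ->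
  #|[set t : n.-tuple V | a < `|path_sum D t|]%SET|%:R
    <= #|V|%:R ^+ n * (2 * expR (2 * sigma * n%:R - a)).
Proof.
move=> D0 Db D2; rewrite -sum1_card natr_sum big_mkcond /=.
pose N h v := - 1 * D h v.
apply: (@le_trans _ _ (\sum_(t : n.-tuple V)
   expR (- a) * (expR (path_sum D t) + expR (path_sum N t)))).
  apply: ler_sum => t _; rewrite inE path_sumZ mulN1r mulrDr -!expRD.
  case: ifPn => [|_]; last by rewrite addr_ge0 ?expR_ge0.
  have h y : a < y -> 1 <= expR (- a + y).
    by move=> ay; apply: (le_trans _ (expR_ge1Dx _)); lra.
  rewrite lter_normr => /orP[] /h h1.
    by apply: (le_trans h1); rewrite lerDl expR_ge0.
  by apply: (le_trans h1); rewrite lerDr expR_ge0.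
rewrite -mulr_sumr big_split /=.
have -> : #|V|%:R ^+ n * (2 * expR (2 * sigma * n%:R - a)) =
   expR (- a) * ((#|V|%:R * expR (2 * sigma)) ^+ n
                + (#|V|%:R * expR (2 * sigma)) ^+ n).
  by rewrite expRD exprMn -expRM_natr; ring.
rewrite ler_wpM2l ?expR_ge0 //; apply: lerD; apply: path_sum_mgf => //.
- by move=> h sh; rewrite -mulr_sumr D0 // mulr0.
- by move=> h v sh; rewrite /N mulN1r normrN Db.
- by move=> h sh; under eq_bigr do rewrite /N mulN1r sqrrN; exact: D2.
Qed.

Lemma scaled_path_sum_tail n (b sigma lam a : R) D :
  0 < lam ->
  (forall h, (size h < n)%N -> \sum_v D h v = 0) ->
  (forall h v, (size h < n)%N -> `|D h v| <= b) ->
  (forall h, (size h < n)%N -> \sum_v D h v ^+ 2 <= #|V|%:R * sigma) ->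
  lam * b <= 2^-1 ->
  #|[set t : n.-tuple V | a < `|path_sum D t|]%SET|%:R
    <= #|V|%:R ^+ n * (2 * expR (2 * lam ^+ 2 * sigma * n%:R - lam * a)).
Proof.
move=> lam0 D0 Db D2 lb.
have := @path_sum_tail n (lam ^+ 2 * sigma) (lam * a) (fun h v => lam * D h v).
rewrite (mulrA 2 (lam ^+ 2)) => H; apply: le_trans (H _ _ _).
- rewrite ler_nat; apply/subset_leq_card/fintype.subsetP => t; rewrite !inE.
  by rewrite path_sumZ normrM (gtr0_norm lam0) ltr_pM2l.
- by move=> h sh; rewrite -mulr_sumr D0 // mulr0.
- move=> h v sh; rewrite normrM (gtr0_norm lam0); apply: le_trans lb.
  by rewrite ler_pM2l // Db.
- move=> h sh; under eq_bigr do rewrite exprMn.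
  by rewrite -mulr_sumr mulrCA ler_wpM2l ?sqr_ge0 // D2.
Qed.

(** Freedman's inequality: the increments need only be bounded on the region
    [q], because the stopped process does not move outside of it. *)
Lemma freedman n q (b sigma lam a : R) D :
  0 < lam -> 0 <= b -> 0 <= sigma ->
  (forall h, (size h < n)%N -> \sum_v D h v = 0) ->
  (forall h v, (size h < n)%N -> q h -> `|D h v| <= b) ->
  (forall h, (size h < n)%N -> q h ->
     \sum_v D h v ^+ 2 <= #|V|%:R * sigma) ->
  lam * b <= 2^-1 ->
  #|[set t : n.-tuple V | a < `|path_sum (stopped q D) t|]%SET|%:R
    <= #|V|%:R ^+ n * (2 * expR (2 * lam ^+ 2 * sigma * n%:R - lam * a)).
Proof.
move=> lam0 b0 s0 D0 Db D2 lb.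
apply: (@scaled_path_sum_tail n b) => //; rewrite /stopped.
- by move=> h sh; case: (all_tails q h); [exact: D0 | rewrite big1].
- move=> h v sh; case: ifP => [/all_tails_self|_]; first exact: Db.
  by rewrite normr0.
- move=> h sh; case E: (all_tails q h); first exact: D2 (all_tails_self E).
  by rewrite big1 ?mulr_ge0 // => v _; rewrite expr0n.
Qed.

End Walks.

(** * Occupation counts and autocorrelations of uniform points *)

Lemma card_exists_le (R : realType) (I J : finType) (Q : I -> pred J) (B : R) :
  (forall i, #|[set j | Q i j]%SET|%:R <= B) ->
  #|[set j | [exists i, Q i j]]%SET|%:R <= #|I|%:R * B.
Proof.
move=> QB; apply: (@le_trans _ _ (\sum_(i : I) #|[set j | Q i j]%SET|%:R)).
  rewrite -natr_sum ler_nat.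
  have -> : [set j | [exists i, Q i j]]%SET = (\bigcup_i [set j | Q i j])%SET.
    apply/setP => j; rewrite inE; apply/existsP/bigcupP => [[i Qi]|[i _]].
      by exists i => //; rewrite inE.
    by rewrite inE => Qi; exists i.
  elim/big_rec2: _ => [|i a B' _ aB]; first by rewrite cards0.
  by rewrite (leq_trans (leq_card_setU _ _).1) // leq_add2l.
rewrite mulr_natl -sumr_const; apply: ler_sum => i _; exact: QB.
Qed.

Lemma all_tails_forall (I V : finType) (q : I -> pred (seq V)) (h : seq V) :
  all_tails (fun h => [forall i, q i h]) h = [forall i, all_tails (q i) h].
Proof.
elim: h => [|v h IH] /=.
  by rewrite andbT; apply: eq_forallb => i; rewrite andbT.
rewrite IH; apply/andP/forallP => [[/forallP a /forallP b] i|ab].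
  by rewrite a b.
by split; apply/forallP => i; have /andP[] := ab i.
Qed.

Section Occupation.
Variables (R : realType) (V : finZmodType).
Implicit Types (u v d : V) (h : seq V).

Let N : R := #|V|%:R.

Let N_gt0 : 0 < N.
Proof. by rewrite ltr0n; apply/card_gt0P; exists 0. Qed.

Let N_neq0 : N != 0.
Proof. exact: lt0r_neq0. Qed.

Definition excess u h : R := (count_mem u h)%:R - (size h)%:R / #|V|%:R.

Lemma excess_cons u v h : excess u (v :: h) = excess u h + ((v == u)%:R - N^-1).
Proof. by rewrite /excess /= natrD -[X in X%:R / _]addn1 natrD -/N; ring. Qed.

Lemma excess_path_sum u h :
  excess u h = path_sum (fun _ v => (v == u)%:R - N^-1) h.
Proof.
elim: h => [|v h IH]; first by rewrite /excess /= mul0r subrr.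
by rewrite excess_cons IH.
Qed.

Lemma sum_count_mem h : \sum_u (count_mem u h)%:R = (size h)%:R :> R.
Proof.
elim: h => [|v h IH] /=; first by rewrite big1.
under eq_bigr do rewrite natrD.
rewrite big_split /= IH -natr_sum -addn1 natrD addrC; congr (_ + _%:R).
rewrite (bigD1 v) //= eqxx big1 ?addn0 // => u.
by rewrite eq_sym => /negPf ->.
Qed.

Lemma sum_excess h : \sum_u excess u h = 0.
Proof.
rewrite big_split /= sum_count_mem sumr_const -mulr_natl -/N.
by field.
Qed.


(** Two bounds, for two regimes: the first is sharp when there are many points
    per site; the second, which replaces one factor [excess u] by the count
    that it centers, when there are few. *)
Lemma sum_excess_sqr_le h (K : R) (n : nat) :
  (forall u, `|excess u h| <= K) -> (size h <= n)%N ->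
  \sum_u excess u h ^+ 2 <= Num.min (N * K ^+ 2) (K * n%:R).
Proof.
move=> hK sh; rewrite le_min; apply/andP; split.
  rewrite /N mulr_natl -sumr_const; apply: ler_sum => u _.
  by rewrite -real_normK ?num_real // ler_sqr ?nnegrE // (le_trans _ (hK u)).
have K0 : 0 <= K := le_trans (normr_ge0 _) (hK 0).
(* The excesses sum to zero, so one factor may be replaced by the raw count. *)
have -> : \sum_u excess u h ^+ 2 = \sum_u excess u h * (count_mem u h)%:R.
  under eq_bigr do rewrite expr2 {2}/excess mulrBr.
  by rewrite sumrB -mulr_suml sum_excess mul0r subr0.
apply: (@le_trans _ _ (K * (size h)%:R)); last by rewrite ler_wpM2l // ler_nat.
rewrite -sum_count_mem mulr_sumr; apply: ler_sum => u _.
by rewrite ler_wpM2r // (le_trans (ler_norm _)).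
Qed.

(** The sum over ordered pairs of distinct points of the centered indicators
    that the points differ by [d]. The pairs of equal indices account for the
    term with [d == 0]. *)
Definition autocorr d h : R :=
  \sum_u (count_mem u h)%:R * (count_mem (u + d) h)%:R
  - (size h)%:R * (d == 0)%:R - (size h)%:R * ((size h)%:R - 1) / #|V|%:R.

Lemma sum_mul_indic (f : V -> R) v : \sum_u f u * (v == u)%:R = f v.
Proof.
rewrite (bigD1 v) //= eqxx mulr1 big1 ?addr0 // => u.
by rewrite eq_sym => /negPf ->; rewrite mulr0.
Qed.

Lemma autocorr_path_sum d h :
  autocorr d h = path_sum (fun h v => excess (v + d) h + excess (v - d) h) h.
Proof.
elim: h => [|v h IH]; first by rewrite /autocorr /= big1 ?mul0r ?subrr // => u _; rewrite mul0r.
rewrite [RHS]/= -{}IH /autocorr.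
have -> : \sum_u (count_mem u (v :: h))%:R * (count_mem (u + d) (v :: h))%:R
  = \sum_u (count_mem u h)%:R * (count_mem (u + d) h)%:R
    + (count_mem (v + d) h)%:R + (count_mem (v - d) h)%:R + (d == 0)%:R :> R.
  rewrite -(sum_mul_indic (fun u => (count_mem (u + d) h)%:R)).
  rewrite -(sum_mul_indic (fun u => (count_mem u h)%:R)).
  have -> : (d == 0)%:R = \sum_u (v == u + d)%:R * (v == u)%:R :> R.
    by rewrite sum_mul_indic addrC -subr_eq subrr eq_sym.
  rewrite -!big_split /=; apply: eq_bigr => u _.
  by rewrite !natrD -subr_eq; ring.
by rewrite /excess /= -[(size h).+1]addn1 natrD -/N; field.
Qed.

Lemma sum_shift (f : V -> R) d : \sum_v f (v + d) = \sum_v f v.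
Proof. by rewrite [RHS](reindex_inj (addIr d)). Qed.

Lemma sum_autocorr_step d h : \sum_v (excess (v + d) h + excess (v - d) h) = 0.
Proof.
by rewrite big_split /= !(sum_shift (fun u => excess u h)) !sum_excess addr0.
Qed.

Lemma sum_autocorr_step_sqr d h :
  \sum_v (excess (v + d) h + excess (v - d) h) ^+ 2
    <= 4 * \sum_u excess u h ^+ 2.
Proof.
set W := \sum_u excess u h ^+ 2.
have -> : 4 * W = \sum_v (2 * excess (v + d) h ^+ 2 + 2 * excess (v - d) h ^+ 2).
  rewrite big_split /= -!mulr_sumr !(sum_shift (fun u => excess u h ^+ 2)) -/W.
  by ring.
apply: ler_sum => v _; rewrite -subr_ge0.
apply: (le_trans (sqr_ge0 (excess (v + d) h - excess (v - d) h))).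
by rewrite le_eqVlt; apply/orP; left; apply/eqP; ring.
Qed.

(** With [lam = 1 / (2 r)], the assumption on [r] makes the variance term at
    most [ln N / 2] while the deviation term is [5 ln N / 2], so each site
    fails for a proportion [2 / N ^ 2] of the tuples. *)
Lemma excess_tail n (r : R) :
  (1 < #|V|)%N -> 1 <= r -> n%:R <= N * ln N * r ^+ 2 ->
  #|[set t : n.-tuple V | ~~ all_tails
      (fun h => [forall u, `|excess u h| <= 5 * ln N * r]) t]%SET|%:R
    <= N ^+ n * (2 / N).
Proof.
move=> V1 r1 nr.
have L0 : 0 < ln N by rewrite ln_gt0 // ltr1n.
have r0 : 0 < r := lt_le_trans ltr01 r1.
set K := 5 * ln N * r.
have K0 : 0 <= K by rewrite !mulr_ge0 // ltW.
pose D u (_ : seq V) v : R := (v == u)%:R - N^-1.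
pose q u h := `|path_sum (D u) h| <= K.
have -> : N ^+ n * (2 / N) = N * (N ^+ n * (2 * expR (- 2 * ln N))).
  by rewrite mulNr expRN expRM_natl lnK //; field.
apply: le_trans (card_exists_le (Q := fun u (t : n.-tuple V) => K < `|path_sum (stopped (q u) (D u)) t|) _).
  rewrite ler_nat; apply/subset_leq_card/fintype.subsetP => t; rewrite !inE.
  rewrite (all_tails_forall (fun u h => `|excess u h| <= K)) negb_forall.
  move=> /existsP[u nu]; apply/existsP; exists u.
  apply: path_sum_stopped_exit => //; apply: contra nu.
  by congr (is_true _); congr all_tails; apply/funext => h; rewrite excess_path_sum.
move=> u; apply: le_trans (@freedman _ _ n _ 1 N^-1 (2 * r)^-1 K _ _ _ _ _ _ _ _) _ => //.
- by rewrite invr_gt0 mulr_gt0.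
- by rewrite invr_ge0 ltW.
- move=> h _; rewrite sumrB sumr_const -mulr_natl -/N mulfV //.
  rewrite (bigD1 u) //= eqxx big1 ?addr0 ?subrr // => v /negPf -> //.
- move=> h v _ _; rewrite /D.
  have : 0 < N^-1 <= 1 by rewrite invr_gt0 N_gt0 invf_le1 // ler1n ltnW.
  by move=> /andP[i0 i1]; rewrite ler_norml; case: (v == u) => /=; lra.
- move=> h _ _; rewrite mulfV //.
  have -> : \sum_v D u h v ^+ 2 = \sum_v ((v == u)%:R * (1 - 2 / N) + N^-1 ^+ 2).
    by apply: eq_bigr => v _; rewrite /D; case: (v == u) => /=; field.
  rewrite big_split /= -mulr_suml sumr_const -[_ *+ #|_|]mulr_natl -/N.
  rewrite (bigD1 u) //= eqxx big1 ?addr0; last by move=> v /negPf ->.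
  rewrite mul1r -subr_ge0.
  have -> : 1 - (1 - 2 / N + N * N^-1 ^+ 2) = N^-1 by field.
  by rewrite invr_ge0 ltW.
- by rewrite mulr1 lef_pV2 ?posrE ?mulr_gt0 // ler_peMr.
rewrite ler_wpM2l ?exprn_ge0 ?(ltW N_gt0) // ler_wpM2l // ler_expR.
rewrite /K.
have -> : 2 * (2 * r)^-1 ^+ 2 * N^-1 * n%:R - (2 * r)^-1 * (5 * ln N * r)
   = 2^-1 * (n%:R / (N * r ^+ 2)) - 5 / 2 * ln N by field; rewrite N_neq0 gt_eqF.
suff : n%:R / (N * r ^+ 2) <= ln N by lra.
by rewrite ler_pdivrMr ?mulr_gt0 ?exprn_gt0 // mulrCA mulrA.
Qed.

(** Inside the region of small excesses, an increment is at most [10 M] and its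
    mean square at most [100 n ln N / N]. With [lam = 1 / (20 M)] the variance
    term is again at most [ln N / 2] and the deviation term [5 ln N / 2]. *)
Lemma autocorr_tail n (r M : R) d :
  (1 < #|V|)%N -> 1 <= r -> 
  Num.min (N * (5 * ln N * r) ^+ 2) ((5 * ln N * r) * n%:R) <= 25 * n%:R * ln N ->
  ln N * r <= M -> n%:R ^+ 2 <= N * M ^+ 2 ->
  #|[set t : n.-tuple V | 50 * ln N * M < `|path_sum (stopped
      (fun h => [forall u, `|excess u h| <= 5 * ln N * r])
      (fun h v => excess (v + d) h + excess (v - d) h)) t|]%SET|%:R
    <= N ^+ n * (2 / N ^+ 2).
Proof.
move=> V1 r1 hW rM nM.
have L0 : 0 < ln N by rewrite ln_gt0 // ltr1n.
have r0 : 0 < r := lt_le_trans ltr01 r1.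
have M0 : 0 < M by apply: lt_le_trans rM; rewrite mulr_gt0.
move: hW; set K := 5 * ln N * r => hW.
have K0 : 0 <= K by rewrite !mulr_ge0 // ltW.
apply: le_trans (@freedman _ _ n _ (2 * K) (100 * n%:R * ln N / N) (20 * M)^-1 _ _ _ _ _ _ _ _ _) _ => //.
- by rewrite invr_gt0 mulr_gt0.
- by rewrite mulr_ge0.
- by rewrite !mulr_ge0 ?invr_ge0 // ltW.
- by move=> h _; exact: sum_autocorr_step.
- move=> h v _ /forallP hK; apply: le_trans (ler_normD _ _) _.
  by rewrite mulr_natl mulr2n lerD.
- move=> h sh /forallP hK; apply: le_trans (sum_autocorr_step_sqr _ _) _.
  rewrite -/N mulrCA mulfV // mulr1.
  have := le_trans (sum_excess_sqr_le hK (ltnW sh)) hW.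
  by lra.
- rewrite mulrC ler_pdivrMr ?mulr_gt0 // /K.
  lra.
rewrite ler_wpM2l ?exprn_ge0 ?(ltW N_gt0) // ler_wpM2l //.
have -> : (N ^+ 2)^-1 = expR (- 2 * ln N).
  by rewrite mulNr expRN expRM_natl lnK.
rewrite ler_expR.
have -> : 2 * (20 * M)^-1 ^+ 2 * (100 * n%:R * ln N / N) * n%:R
      - (20 * M)^-1 * (50 * ln N * M)
   = 2^-1 * (n%:R ^+ 2 / (N * M ^+ 2)) * ln N - 5 / 2 * ln N by field; rewrite N_neq0 gt_eqF.
suff : n%:R ^+ 2 / (N * M ^+ 2) <= 1.
  move=> h; have := ler_wpM2r (ltW L0) h; lra.
by rewrite ler_pdivrMr ?mulr_gt0 ?exprn_gt0 // mul1r.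
Qed.

(** The scale [r] of the excesses is [1] in the sparse regime [n <= N ln N],
    where counts have Poisson-like tails of order [ln N], and
    [sqrt (n / (N ln N))] otherwise, which gives the Gaussian order
    [sqrt (n ln N / N)]. *)
Lemma autocorr_concentration n (M : R) :
  (1 < #|V|)%N -> ln N <= M -> n%:R ^+ 2 <= N * M ^+ 2 ->
  #|[set t : n.-tuple V | [exists d, 50 * ln N * M < `|autocorr d t|]]%SET|%:R
    <= N ^+ n * (4 / N).
Proof.
move=> V1 LM nM.
have L0 : 0 < ln N by rewrite ln_gt0 // ltr1n.
have M0 : 0 < M := lt_le_trans L0 LM.
have [r [r1 nr hW rM]] : exists r : R, [/\ 1 <= r, n%:R <= N * ln N * r ^+ 2,
   Num.min (N * (5 * ln N * r) ^+ 2) ((5 * ln N * r) * n%:R) <= 25 * n%:R * ln N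
   & ln N * r <= M].
  have [nNL|nNL] := leP n%:R (N * ln N).
    exists 1; rewrite expr1n !mulr1; split => //.
    have nL0 : 0 <= n%:R * ln N by rewrite mulr_ge0 // ltW.
    by rewrite ge_min; apply/orP; right; lra.
  have NL0 : 0 < N * ln N by rewrite mulr_gt0.
  have nn0 : 0 < n%:R :> R := lt_trans NL0 nNL.
  set r := Num.sqrt (n%:R / (N * ln N)).
  have r2 : r ^+ 2 = n%:R / (N * ln N) by rewrite sqr_sqrtr // divr_ge0 // ltW.
  have e : N * ln N * r ^+ 2 = n%:R by rewrite r2 mulrCA mulfV ?mulr1 // gt_eqF.
  exists r; split.
  - by rewrite -sqrtr1 ler_wsqrtr // ler_pdivlMr // mul1r ltW.
  - by rewrite e.
  - have -> : N * (5 * ln N * r) ^+ 2 = 25 * n%:R * ln N by rewrite -e; ring.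
    by rewrite ge_min lexx.
  have Lr0 : 0 <= ln N * r by rewrite mulr_ge0 ?sqrtr_ge0 // ltW.
  rewrite -ler_sqr ?nnegrE ?(ltW M0) // -(ler_pM2l N_gt0); apply: le_trans nM.
  have -> : N * (ln N * r) ^+ 2 = ln N * n%:R by rewrite -e; ring.
  rewrite expr2 ler_pM2r //; apply: le_trans (ltW nNL).
  by rewrite ler_peMl ?(ltW L0) // ler1n ltnW.
set q := fun h => [forall u, `|excess u h| <= 5 * ln N * r].
pose D d h v := excess (v + d) h + excess (v - d) h.
pose B1 := [set t : n.-tuple V | ~~ all_tails q t]%SET.
pose B2 := [set t : n.-tuple V |
  [exists d, 50 * ln N * M < `|path_sum (stopped q (D d)) t|]]%SET.
apply: (@le_trans _ _ (#|B1|%:R + #|B2|%:R)).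
  rewrite -natrD ler_nat; apply: leq_trans (leq_card_setU _ _).1.
  apply/subset_leq_card/fintype.subsetP => t; rewrite !inE => /existsP[d hd].
  case: (boolP (all_tails q t)) => //= qt.
  by apply/existsP; exists d; rewrite path_sum_stopped // -autocorr_path_sum.
(* One term for the excesses, and one for the union over the shifts [d]. *)
have -> : N ^+ n * (4 / N) = N ^+ n * (2 / N) + N * (N ^+ n * (2 / N ^+ 2)).
  by field.
apply: lerD; first exact: excess_tail.
by apply: card_exists_le => d; exact: autocorr_tail.
Qed.

End Occupation.

(** * The Gram matrix of the centered design *)

Section Gram.
Variables (R : realType) (m p' : nat).
Let p := p'.+2.
Variable u : 'I_m -> 'I_p.

Lemma counts_sub (l k : 'I_p) :
  counts u (l%:Z - k%:Z) = count_mem (l - k) [tuple u i | i < m].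
Proof.
rewrite /counts -sum1_card -sum1_count big_tuple; apply: eq_bigl => i.
rewrite inE tnth_mktuple /= -(eqz_modDr k%:Z) subrK -PoszD !modz_nat eqz_nat.
rewrite (modn_small (ltn_ord l)) -subr_eq opprK.
by apply/eqP/eqP => [e|<-//]; apply: val_inj.
Qed.

Hypothesis m_gt0 : (0 < m)%N.

(** All columns of the convolution matrix sum to [m], so centering subtracts the
    constant [(m - 1) / p] from all entries of its normalized Gram matrix;
    this is the mean of the off-diagonal entries. *)
Lemma gram_tilde_mx (k k' : 'I_p) :
  ((tilde_mx R u)^T *m tilde_mx R u) k k'
    = (k == k')%:R + autocorr R (k - k') [tuple u i | i < m] / m%:R.
Proof.
set t := [tuple u i | i < m].
pose c (v : 'I_p) : R := (count_mem v t)%:R.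
pose a := (Num.sqrt m%:R : R)^-1; pose b := (Num.sqrt m%:R - 1) / p%:R : R.
have te l j : tilde_mx R u l j = a * c (l - j) - b.
  by rewrite /tilde_mx !mxE big_ord1 !mxE !mulr1 counts_sub.
rewrite mxE; under eq_bigr do rewrite mxE !te.
have sc j : \sum_l c (l - j) = m%:R.
  by rewrite (sum_shift c) sum_count_mem size_tuple.
have -> : \sum_l (a * c (l - k) - b) * (a * c (l - k') - b)
  = a ^+ 2 * (\sum_v c v * c (v + (k - k'))) - 2 * a * b * m%:R + p%:R * b ^+ 2.
  rewrite -(sum_shift (fun v => c v * c (v + (k - k'))) (- k)).
  have -> : 2 * a * b * m%:R
     = \sum_l (a * b * c (l - k)) + \sum_l (a * b * c (l - k')).
    by rewrite -!mulr_sumr !sc; ring.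
  have -> : p%:R * b ^+ 2 = \sum_(l < p) b ^+ 2.
    by rewrite sumr_const card_ord mulr_natl.
  rewrite mulr_sumr -big_split /= -sumrB -big_split /=; apply: eq_bigr => l _.
  have -> : l - k + (k - k') = l - k' by rewrite addrA subrK.
  ring.
pose W := \sum_v c v * c (v + (k - k')).
have -> : autocorr R (k - k') t
    = W - m%:R * (k == k')%:R - m%:R * (m%:R - 1) / p%:R.
  by rewrite /autocorr size_tuple card_ord subr_eq0.
have p0 : p%:R != 0 :> R by rewrite pnatr_eq0.
rewrite -/W /a /b; set s := Num.sqrt m%:R.
have s0 : s != 0 by rewrite sqrtr_eq0 -ltNge ltr0n.
have <- : s ^+ 2 = m%:R by rewrite sqr_sqrtr.
by field; rewrite s0.
Qed.

End Gram.

(** * Matrices close to the identity *)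

Section NearIsometry.
Variables (R : realType) (I : finType) (S : {set I}).

Lemma sqr_sum_norm_le (z : I -> R) :
  (\sum_(j in S) `|z j|) ^+ 2 <= #|S|%:R * \sum_(j in S) z j ^+ 2.
Proof.
rewrite expr2 mulr_suml.
apply: (@le_trans _ _ (\sum_(i in S) \sum_(j in S) (z i ^+ 2 + z j ^+ 2) / 2)).
  apply: ler_sum => i _; rewrite mulr_sumr; apply: ler_sum => j _.
  have := sqr_ge0 (`|z i| - `|z j|).
  rewrite -[z i ^+ 2]real_normK ?num_real // -[z j ^+ 2]real_normK ?num_real //.
  by nra.
under eq_bigr => i _ do rewrite -mulr_suml big_split /= sumr_const.
rewrite -mulr_suml big_split /= sumr_const sumrMnl -mulr_natl.
by lra.
Qed.

(** Cauchy-Schwarz gives [|(G - 1) z| <= |S| eps |z| <= |z| / 2]; both bounds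
    then follow from [(a + b) ^ 2 <= 2 a ^ 2 + 2 b ^ 2]. *)
Lemma near_identity_bounds (G : I -> I -> R) (eps : R) (z : I -> R) :
  #|S|%:R * eps <= 2^-1 ->
  (forall k j, k \in S -> j \in S -> `|G k j - (k == j)%:R| <= eps) ->
  3^-1 * \sum_(k in S) (\sum_(j in S) G k j * z j) ^+ 2
    <= \sum_(k in S) z k ^+ 2
    <= 4 * \sum_(k in S) (\sum_(j in S) G k j * z j) ^+ 2.
Proof.
move=> Se hG.
pose y k := \sum_(j in S) G k j * z j.
pose Z := \sum_(k in S) z k ^+ 2.
rewrite -/Z; set E := \sum_(k in S) _.
have Z0 : 0 <= Z by apply: sumr_ge0 => k _; exact: sqr_ge0.
have rZ : \sum_(k in S) (y k - z k) ^+ 2 <= Z / 4.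
  have [->|/set0Pn[i0 i0S]] := eqVneq S finset.set0.
    by rewrite big_set0 divr_ge0.
  have e0 : 0 <= eps := le_trans (normr_ge0 _) (hG i0 i0 i0S i0S).
  apply: (@le_trans _ _ (\sum_(k in S) eps ^+ 2 * (#|S|%:R * Z))).
    apply: ler_sum => k kS.
    have -> : y k - z k = \sum_(j in S) (G k j - (k == j)%:R) * z j.
      under eq_bigr do rewrite mulrBl; rewrite sumrB; congr (_ - _).
      rewrite (bigD1 k) //= eqxx mul1r big1 ?addr0 // => j /andP[_ jk].
      by rewrite eq_sym (negPf jk) mul0r.
    have h : `|\sum_(j in S) (G k j - (k == j)%:R) * z j|
        <= eps * \sum_(j in S) `|z j|.
      apply: le_trans (ler_norm_sum _ _ _) _; rewrite mulr_sumr.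
      by apply: ler_sum => j jS; rewrite normrM ler_wpM2r // hG.
    rewrite -real_normK ?num_real //.
    apply: (@le_trans _ _ ((eps * \sum_(j in S) `|z j|) ^+ 2)).
      by rewrite ler_sqr ?nnegrE // (le_trans _ h).
    by rewrite exprMn ler_wpM2l ?sqr_ge0 // sqr_sum_norm_le.
  rewrite sumr_const -[_ *+ #|_|]mulr_natl.
  have -> : #|S|%:R * (eps ^+ 2 * (#|S|%:R * Z)) = (#|S|%:R * eps) ^+ 2 * Z by ring.
  rewrite mulrC ler_wpM2l //.
  have -> : 4^-1 = 2^-1 ^+ 2 :> R by field.
  by rewrite ler_sqr ?nnegrE ?mulr_ge0 // invr_ge0.
have h1 : E <= 2 * Z + 2 * \sum_(k in S) (y k - z k) ^+ 2.
  rewrite !mulr_sumr -big_split /=; apply: ler_sum => k _; rewrite -/(y k).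
  by have := sqr_ge0 (y k - 2 * z k); nra.
have h2 : Z <= 2 * E + 2 * \sum_(k in S) (y k - z k) ^+ 2.
  rewrite !mulr_sumr -big_split /=; apply: ler_sum => k _; rewrite -/(y k).
  by have := sqr_ge0 (2 * y k - z k); nra.
by apply/andP; split; lra.
Qed.

End NearIsometry.

(** * Least squares on a given support *)

Section LeastSquares.
Variables (R : realType) (p : nat) (S : {set 'I_p}) (At : 'M[R]_p) (Yt : 'cV[R]_p).

Lemma mul_colsel1 (n : nat) (B : 'M[R]_(n, p)) : B *m colsel S 1%:M = colsel S B.
Proof.
apply/matrixP => i j; rewrite !mxE (bigD1 (enum_val j)) //= !mxE eqxx mulr1.
by rewrite big1 ?addr0 // => k /negPf kj; rewrite !mxE kj mulr0.
Qed.

Lemma oracle_ols_outside k : k \notin S -> oracle_ols S At Yt k 0 = 0.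
Proof.
move=> kS; rewrite /oracle_ols -mulmxA mxE big1 // => j _.
rewrite !mxE; case: eqP => [kj|_]; last by rewrite mul0r.
by move: kS; rewrite kj enum_valP.
Qed.

(** For [B] the selected columns, [B^T B B^# = (B B^# B)^T = B^T] since [B B^#] is
    symmetric. *)
Lemma oracle_ols_normal_equation k :
  k \in S -> (At^T *m (Yt - At *m oracle_ols S At Yt)) k 0 = 0.
Proof.
move=> kS; set B := colsel S At.
have [BXB _ BX _] := mpinvP B.
have eB : At *m oracle_ols S At Yt = B *m mpinv B *m Yt.
  by rewrite /oracle_ols !mulmxA mul_colsel1.
have BTBX : B^T *m (B *m mpinv B) = B^T by rewrite -BX -trmx_mul BXB.
have : B^T *m (Yt - B *m mpinv B *m Yt) = 0.
  by rewrite mulmxBr mulmxA BTBX subrr.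
move=> /matrixP/(_ (enum_rank_in kS k) 0); rewrite eB [RHS]mxE => <-.
rewrite !mxE; apply: eq_bigr => l _.
by rewrite !mxE enum_rankK_in.
Qed.

Lemma oracle_ols_error_outside (x : 'cV[R]_p) k :
  supp x = S -> k \notin S -> (oracle_ols S At Yt - x) k 0 = 0.
Proof.
move=> xS kS; rewrite mxE oracle_ols_outside // add0r mxE.
by move: kS; rewrite -xS inE negbK => /eqP ->; rewrite oppr0.
Qed.

(** By the normal equations the part of the residual that is not explained by
    the selected columns is invisible on [S]. *)
Lemma oracle_ols_residual (x : 'cV[R]_p) k :
  supp x = S -> k \in S ->
  (At^T *m (Yt - At *m x)) k 0
    = \sum_(j in S) (At^T *m At) k j * (oracle_ols S At Yt - x) j 0.
Proof.
move=> xS kS; set xh := oracle_ols S At Yt.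
have -> : Yt - At *m x = (Yt - At *m xh) + At *m (xh - x).
  by rewrite mulmxBr addrA subrK.
rewrite mulmxDr mxE oracle_ols_normal_equation // add0r mulmxA mxE.
rewrite [RHS]big_mkcond /=; apply: eq_bigr => j _.
by case: ifPn => // jS; rewrite oracle_ols_error_outside // mulr0.
Qed.

Lemma oracle_ols_error_bounds (x : 'cV[R]_p) (eps : R) :
  supp x = S -> #|S|%:R * eps <= 2^-1 ->
  (forall k j, `|(At^T *m At) k j - (k == j)%:R| <= eps) ->
  let E := \sum_(k in S) (At^T *m (Yt - At *m x)) k 0 ^+ 2 in
  3^-1 * E <= l2norm (oracle_ols S At Yt - x) ^+ 2 <= 4 * E.
Proof.
move=> xS Se hG; cbv zeta; set E := \sum_(k in S) _.
have -> : l2norm (oracle_ols S At Yt - x) ^+ 2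
    = \sum_(k in S) (oracle_ols S At Yt - x) k 0 ^+ 2.
  rewrite /l2norm sqr_sqrtr; last by apply: sumr_ge0 => k _; exact: sqr_ge0.
  rewrite [RHS]big_mkcond /=; apply: eq_bigr => k _.
  by case: ifPn => // kS; rewrite oracle_ols_error_outside // expr0n.
have -> : E = \sum_(k in S) (\sum_(j in S)
    (At^T *m At) k j * (oracle_ols S At Yt - x) j 0) ^+ 2.
  by apply: eq_bigr => k kS; rewrite oracle_ols_residual.
by apply: (near_identity_bounds (G := fun k j => (At^T *m At) k j)
  (fun k => (oracle_ols S At Yt - x) k 0) Se) => k j _ _; exact: hG.
Qed.

End LeastSquares.

(** * Events and probabilities for the random model *)

Section Law.
Context (R : realType) (d : measure_display) (T : measurableType d)
  (P : probability T R).
Local Open Scope ereal_scope.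

Lemma measurable_countable_fibers (C : countType) (Z : T -> C) (A : set C) :
  (forall z, measurable (Z @^-1` [set z])) -> measurable (Z @^-1` A).
Proof.
move=> mZ.
have -> : Z @^-1` A = \bigcup_z (if z \in A then Z @^-1` [set z] else set0).
  apply/seteqP; split=> [w Aw|w [z _]].
    by exists (Z w) => //; rewrite mem_set.
  by case: ifPn => // /set_mem Az /= ->.
apply: countable_bigcupT_measurable => [|z]; first exact: countableP.
by case: ifP.
Qed.

(** The model only takes countably many values, so every event that it determines
    is a countable union of measurable fibers; the event of the theorem is
    not otherwise visibly measurable, because of the pseudo-inverse. *)
Lemma measurable_pair_fibers (m p : nat) (U : 'I_m -> T -> 'I_p)
    (Y : 'I_p -> {RV P >-> nat})
    (A : ('I_m -> 'I_p) -> ('I_p -> nat) -> Prop) :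
  (forall i (B : set 'I_p), measurable (U i @^-1` B)) ->
  measurable [set w | A (U^~ w) (Y^~ w)].
Proof.
move=> mU.
pose C : countType := ({ffun 'I_m -> 'I_p} * {ffun 'I_p -> nat})%type.
pose Z w : C := ([ffun i => U i w], [ffun l => Y l w : nat]).
have -> : [set w | A (U^~ w) (Y^~ w)] = Z @^-1` [set z : C | A z.1 z.2].
  apply/seteqP; split => w; rewrite /preimage /=;
    suff [-> ->] : [ffun i => U i w] = U^~ w :> (_ -> _)
                /\ [ffun l => Y l w : nat] = Y^~ w :> (_ -> _) by [];
    by split; apply/funext => i; rewrite ffunE.
apply: measurable_countable_fibers => z.
have -> : Z @^-1` [set z] = (\bigcap_(i in [set: 'I_m]) (U i @^-1` [set z.1 i]))
    `&` (\bigcap_(l in [set: 'I_p]) (Y l @^-1` [set z.2 l])).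
  apply/seteqP; split => w /=.
    by move=> <-; split => i _ /=; rewrite ffunE.
  case=> Uz Yz; rewrite [z]surjective_pairing; congr (_, _).
    by apply/ffunP => i; rewrite ffunE; exact: Uz.
  by apply/ffunP => l; rewrite ffunE; exact: Yz.
apply: measurableI; apply: fin_bigcap_measurable => // i _.
exact: measurable_sfunP.
Qed.

Lemma iid_uniform_count (m p : nat) (U : 'I_m -> T -> 'I_p)
    (B : {set m.-tuple 'I_p}) :
  iid_uniform P U ->
  P [set w | [tuple U i w | i < m] \in B] = (#|B|%:R / p%:R ^+ m)%:E.
Proof.
move=> [mU uU iU].
have F1 (t : m.-tuple 'I_p) :
  P [set w | [tuple U i w | i < m] = t] = (p%:R ^- m)%:E.
  have -> : [set w | [tuple U i w | i < m] = t]
     = [set w | forall i, [set tnth t i] (U i w)].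
    apply/seteqP; split=> w /=.
      by move=> <- i; rewrite tnth_mktuple.
    by move=> Ut; apply: eq_from_tnth => i; rewrite tnth_mktuple Ut.
  rewrite (iU (fun i => [set tnth t i])); under eq_bigr do rewrite uU.
  by rewrite prodEFin prodr_const card_ord exprVn.
have mF (t : m.-tuple 'I_p) : measurable [set w | [tuple U i w | i < m] = t].
  have -> : [set w | [tuple U i w | i < m] = t]
     = \bigcap_(i in [set: 'I_m]) (U i @^-1` [set tnth t i]).
    apply/seteqP; split=> w /=.
      by move=> <- i _; rewrite /= tnth_mktuple.
    by move=> Ut; apply: eq_from_tnth => i; rewrite tnth_mktuple; exact: Ut.
  exact: fin_bigcap_measurable.
have -> : [set w | [tuple U i w | i < m] \in B]
    = \bigcup_(t in [set` enum B]) [set w | [tuple U i w | i < m] = t].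
  apply/seteqP; split=> w /=.
    by move=> BU; exists [tuple U i w | i < m] => //=; rewrite mem_enum.
  by case=> t /=; rewrite mem_enum => tB ->.
rewrite measure_fin_bigcup //.
- rewrite -fsbig_seq ?enum_uniq // (eq_bigr (fun=> (p%:R ^- m)%:E)) => [|t _]; last exact: F1.
  by rewrite sumEFin big_enum sumr_const mulr_natl.
- by move=> t t' _ _ [w [/= <- <-]].
Qed.

End Law.

(** With [L = ln p], [q = sqrt p], [n = m]: each of the two sparsity constraints
    handles one of the two terms of the maximum. *)
Lemma sparsity_budget (R : realType) (L q n s : R) :
  0 < L -> 0 < q -> 0 <= n ->
  s <= 100^-1 * Num.min (q / L) (n / L ^+ 2) ->
  s * (50 * L * Num.max L (n / q)) <= n / 2.
Proof.
move=> L0 q0 n0; rewrite mulrC ler_pdivlMr // le_min.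
rewrite !ler_pdivlMr ?exprn_gt0 // => /andP[sq sn].
rewrite /Num.max; case: ifP => _; last by lra.
have : s * 100 * L * (n / q) <= q * (n / q) by rewrite ler_wpM2r // divr_ge0 // ltW.
have -> : q * (n / q) = n by rewrite mulrCA mulfV ?mulr1 ?gt_eqF.
by lra.
Qed.

(** * The oracle least squares error *)

Theorem proposition5 (R : realType) :
  exists c0 c1 c2 C : R,
    [/\ 0 < c0, 0 < c1, 0 < c2 & 0 < C] /\
    forall (m p : nat) (x : 'cV[R]_p)
      (d : measure_display) (T : measurableType d) (P : probability T R)
      (U : 'I_m -> T -> 'I_p) (Y : 'I_p -> {RV P >-> nat}),
      (2 <= m)%N -> (2 <= p)%N ->
      (forall k, 0 <= x k 0) ->
      (1 <= #|supp x| < minn m p)%N ->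
      #|supp x|%:R <= c0 * Num.min (Num.sqrt p%:R / ln p%:R)
                                   (m%:R / ln p%:R ^+ 2) ->
      iid_uniform P U ->
      cond_poisson U (fun u => convmx R u *m x) Y ->
      ((1 - C / p%:R)%R%:E <
        P [set w |
           (let At := tilde_mx R (fun i => U i w) in
            let Yt := tilde_vec m (\col_l (Y l w)%:R) in
            let xhat := oracle_ols (supp x) At Yt in
            let E := \sum_(k in supp x)
                       (At^T *m (Yt - At *m x)) k 0 ^+ 2 in
            c1 * E <= l2norm (xhat - x) ^+ 2 <= c2 * E)%R])%E.
Proof.
exists 100^-1, 3^-1, 4, 5; split; first by split; rewrite ?invr_gt0.
(* The cyclic group structure on ['I_p] is found only for [p] of the form
   [_.+1]. *)
move=> m [|[|p']] // x d T P U Y m2 _ _ _ sx iidU _.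
set p := p'.+2 in x U Y sx iidU *.
have m0 : 0 < m%:R :> R by rewrite ltr0n ltnW.
have p0 : 0 < p%:R :> R by rewrite ltr0n.
have L0 : 0 < ln p%:R :> R by rewrite ln_gt0 // ltr1n.
set M := Num.max (ln p%:R) (m%:R / Num.sqrt p%:R) : R.
(* The entrywise accuracy of the Gram matrix guaranteed off [bad] below. *)
set eps := 50 * ln p%:R * M / m%:R.
have Seps : #|supp x|%:R * eps <= 2^-1.
  rewrite /eps mulrA ler_pdivrMr // mulrC [2^-1 * _]mulrC.
  by rewrite mulrC sparsity_budget // sqrtr_gt0.
set ok := (X in P [set w | X w]).
pose bad := [set t : m.-tuple 'I_p |
  [exists v, 50 * ln p%:R * M < `|autocorr R v t|]]%SET.
have badP : #|bad|%:R <= p%:R ^+ m * (4 / p%:R) :> R.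
  have := @autocorr_concentration R 'I_p m M; rewrite card_ord; apply => //.
    by rewrite /M le_max lexx.
  have -> : m%:R ^+ 2 = p%:R * (m%:R / Num.sqrt p%:R) ^+ 2 :> R.
    by rewrite exprMn exprVn sqr_sqrtr // mulrCA mulfV ?mulr1 ?gt_eqF.
  rewrite ler_wpM2l // ler_sqr ?nnegrE ?divr_ge0 ?sqrtr_ge0 //.
    by rewrite /M le_max lexx orbT.
  by rewrite /M le_max ltW.
have good_ok : [set w | [tuple U i w | i < m] \in (~: bad)%SET] `<=` [set w | ok w].
  move=> w /=; rewrite !inE negb_exists => /forallP good.
  apply: oracle_ols_error_bounds Seps _ => // k j.
  rewrite gram_tilde_mx; last exact: ltnW.
  rewrite addrAC subrr add0r normrM normfV (gtr0_norm m0) ler_pM2r ?invr_gt0 //.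
  by rewrite leNgt good.
have mU : forall i (B : set 'I_p), measurable (U i @^-1` B) by case: iidU.
have m_ok : measurable [set w | ok w].
  apply: (measurable_pair_fibers Y (fun u y =>
   (let At := tilde_mx R u in
    let Yt := tilde_vec m (\col_l (y l)%:R) in
    let xhat := oracle_ols (supp x) At Yt in
    let E := \sum_(k in supp x) (At^T *m (Yt - At *m x)) k 0 ^+ 2 in
    3^-1 * E <= l2norm (xhat - x) ^+ 2 <= 4 * E)%R) mU).
apply: (@lt_le_trans _ _ (1 - 4 / p%:R)%:E).
  by rewrite lte_fin ltrD2l ltrN2 ltr_pM2r ?invr_gt0 // ltr_nat.
have m_good : measurable [set w | [tuple U i w | i < m] \in (~: bad)%SET].
  exact: (measurable_pair_fibers Y (fun u _ =>
    [tuple u i | i < m] \in (~: bad)%SET) mU).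
have le_good_ok : (P [set w | [tuple U i w | i < m] \in (~: bad)%SET]
    <= P [set w | ok w])%E by apply: le_measure good_ok; exact: mem_set.
apply: le_trans le_good_ok.
rewrite (iid_uniform_count _ iidU).
rewrite lee_fin ler_pdivlMr ?exprn_gt0 //.
have -> : #|(~: bad)%SET|%:R = p%:R ^+ m - #|bad|%:R :> R.
  have -> : p%:R ^+ m = (#|bad| + #|(~: bad)%SET|)%:R :> R.
    by rewrite cardsC card_tuple card_ord natrX.
  by rewrite natrD addrAC subrr add0r.
by rewrite mulrBl mul1r lerD2l lerN2 mulrC.
Qed.
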